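(* Let $A:\mathcal F\to\mathcal F$ be a mapping and let $k$ be a nonnegative integer. Let $r\ge \log 2$ and suppose that $$\bar T^\sharp_{r+k,n}(A[f])\le \bar T^\sharp_{r+k,n}(f)\quad\text{for all } f\in\mathcal F,\qquad\text{and}\qquad |A[\mathcal F]|\le e^{k},$$ where $A[\mathcal F]=\{A[f]: f\in\mathcal F\}$ is the range of $A$. Let $$\mathcal A=\{f-A[f]: f\in\mathcal F\},\qquad \underline{\ell}=\lfloor \log_2(r/3)\rfloor .$$ Then, with probability at least $1-2e^{-r}$, for all $f\in\mathcal F$ simultaneously, $$\mathbb E_n f(X)-\bar T^\sharp_{r+k,n}(f)-\min\left\{2\bar T^\sharp_{2r+1,n}(f-A[f]),\ \mathrm{rad}^\sharp_{2r+1,n}(\mathcal A)\right\}\le 2\gamma^\sharp(\mathcal A;r,\underline{\ell},n).$$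
   Context: $X$ is a random variable with values in a space $\mathcal X$, $X_1,\dots,X_n$ are i.i.d. copies of $X$, and $\mathbb E_n f(X)=\frac1n\sum_{i=1}^n f(X_i)$ is the empirical average. $\mathbb V$ is the vector space of (measurable) functions $g:\mathcal X\to\mathbb R$ with $\mathbb E|g(X)|<\infty$ and $\mathbb E g(X)=0$. $\mathcal F\subset\mathbb V$ is a finite set containing the zero function. For $s\ge0$ and $g\in\mathbb V$, with $(x)_+=\max(x,0)$, $$T^\sharp_{s,n}(g)=\inf_{t\in\mathbb R}\ t+e^{s}\,\mathbb E\big((\mathbb E_n g(X)-t)_+\big),\qquad \bar T^\sharp_{s,n}(g)=\max\{T^\sharp_{s,n}(g),T^\sharp_{s,n}(-g)\}.$$ For $g\in\mathbb V$ and $\mathcal H\subseteq\mathbb V$, $\varrho^\sharp_{s,n}(g,\mathcal H)=\inf_{h\in\mathcal H}\bar T^\sharp_{s,n}(g-h)$. For $\mathcal A\subseteq\mathbb V$, $\mathrm{rad}^\sharp_{s,n}(\mathcal A)=\max_{a\in\mathcal A}\bar T^\sharp_{s,n}(a)$. For an integer $\underline{\ell}$, $$\gamma^\sharp(\mathcal A;r,\underline{\ell},n)=\inf_{(\mathcal A_i)_{i\ge0}}\ \sup_{a\in\mathcal A}\ \sum_{\ell\ge\underline{\ell}}\varrho^\sharp_{r+(r+1)2^{\ell-\underline{\ell}},\,n}(a,\mathcal A_\ell),$$ where the infimum is over increasing (with respect to inclusion) sequences $(\mathcal A_i)_{i\ge0}$ of subsets of $\mathcal A$ with $\mathcal A_0=\{0\}$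 and $|\mathcal A_i|\le 2^{2^i}$ for $i\ge1$. If $\underline{\ell}<0$, set $\mathcal A_\ell=\{0\}$ for $\ell<0$. *)

(* Defs.v *)
From HB Require Import structures.
From mathcomp Require Import all_boot all_order all_algebra finmap.
From mathcomp Require Import all_classical all_reals all_analysis.

Set Implicit Arguments.
Unset Strict Implicit.
Unset Printing Implicit Defensive.

Import Order.TTheory GRing.Theory Num.Theory.
Import numFieldNormedType.Exports.

Local Open Scope classical_set_scope.
Local Open Scope ring_scope.

(* The family is finite and some of the events may be the whole space, so the
   product rule for the full family contains the one for every subfamily. *)
Definition mutually_independent d d' (Omega : measurableType d)
    (S : measurableType d') (R : realType) (P : probability Omega R) (n : nat)
    (Xs : 'I_n -> {mfun Omega >-> S}) : Prop :=
  forall E : 'I_n -> set S, (forall i, measurable (E i)) ->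
    P (\bigcap_i (Xs i @^-1` E i)) = (\prod_(i < n) P (Xs i @^-1` E i))%E.

(* Laws are only compared on measurable sets: [P] has no meaning elsewhere. *)
Definition iid_copies d d' (Omega : measurableType d) (S : measurableType d')
    (R : realType) (P : probability Omega R) (X : {mfun Omega >-> S}) (n : nat)
    (Xs : 'I_n -> {mfun Omega >-> S}) : Prop :=
  mutually_independent P Xs /\
  forall i (E : set S), measurable E ->
    distribution P (Xs i) E = distribution P X E.

Definition centered_integrable d d' (Omega : measurableType d)
    (S : measurableType d') (R : realType) (P : probability Omega R)
    (X : {mfun Omega >-> S}) : set (S -> R) :=
  [set g | [/\ measurable_fun setT g,
               P.-integrable setT (EFin \o (g \o X)) &
               ('E_P[g \o X] = 0)%E]].

Definition emp_mean (Omega S : Type) (R : realType) (n : nat)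
    (Xs : 'I_n -> Omega -> S) (g : S -> R) : Omega -> R :=
  fun w => n%:R^-1 * \sum_(i < n) g (Xs i w).

(* All quantities below are extended reals, so that an infimum over the empty
   set and a divergent series are both [+oo]. *)
Definition Tsharp d d' (Omega : measurableType d) (S : measurableType d')
    (R : realType) (P : probability Omega R) (n : nat)
    (Xs : 'I_n -> {mfun Omega >-> S}) (s : R) (g : S -> R) : \bar R :=
  ereal_inf [set (t%:E + (expR s)%:E *
                  'E_P[fun w => Num.max (emp_mean Xs g w - t)%R 0%R])%E
            | t in [set: R]].

Definition Tsharp_bar d d' (Omega : measurableType d) (S : measurableType d')
    (R : realType) (P : probability Omega R) (n : nat)
    (Xs : 'I_n -> {mfun Omega >-> S}) (s : R) (g : S -> R) : \bar R :=
  maxe (Tsharp P Xs s g) (Tsharp P Xs s (\- g)).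

Definition rho_sharp d d' (Omega : measurableType d) (S : measurableType d')
    (R : realType) (P : probability Omega R) (n : nat)
    (Xs : 'I_n -> {mfun Omega >-> S}) (s : R) (g : S -> R)
    (H : set (S -> R)) : \bar R :=
  ereal_inf [set Tsharp_bar P Xs s (g \- h) | h in H].

(* For a nonempty finite set the supremum is a maximum. *)
Definition rad_sharp d d' (Omega : measurableType d) (S : measurableType d')
    (R : realType) (P : probability Omega R) (n : nat)
    (Xs : 'I_n -> {mfun Omega >-> S}) (s : R) (calA : set (S -> R)) : \bar R :=
  ereal_sup [set Tsharp_bar P Xs s a | a in calA].

Definition admissible (S : Type) (R : realType) (calA : set (S -> R))
    (B : nat -> set (S -> R)) : Prop :=
  [/\ forall i, B i `<=` calA,
      forall i j, (i <= j)%N -> B i `<=` B j,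
      B 0%N = [set cst 0] &
      forall i, (1 <= i)%N -> (B i #<= `I_(2 ^ (2 ^ i))%N)%card].

Definition int_level (S : Type) (R : realType) (B : nat -> set (S -> R))
    (l : int) : set (S -> R) :=
  match l with Posz i => B i | Negz _ => [set cst 0] end.

(* The levels l >= l0 are enumerated as l = l0 + j with j : nat. *)
Definition gamma_sharp d d' (Omega : measurableType d) (S : measurableType d')
    (R : realType) (P : probability Omega R) (n : nat)
    (Xs : 'I_n -> {mfun Omega >-> S}) (calA : set (S -> R)) (r : R)
    (l0 : int) : \bar R :=
  ereal_inf
    [set ereal_sup
       [set (\sum_(0 <= j <oo)
               rho_sharp P Xs (r + (r + 1) * 2 ^+ j)%R a
                 (int_level B (l0 + j%:Z)%R))%E
       | a in calA]
    | B in admissible calA].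

(* Main.v *)
(* The quantity Tsharp is the conditional value at risk of the empirical mean at
   tail probability e^-s: it is subadditive in the function, and the empirical
   mean exceeds it with probability at most e^-s. A union bound over the at most
   e^k functions A[f] at level r + k controls the empirical mean of A[f] by
   Tsharp_bar of f, outside an event of probability e^-r. The remainder f - A[f]
   is handled by generic chaining: each a in calA is reached through its nearest
   points pi_j(a) in the successive sets of an admissible sequence. Level j has
   at most e^(r 2^j) links, each failing with probability
   e^(- r - (r + 1) 2^j), so that all links and the starting points are
   controlled simultaneously except on an event of probability at most
   e^-r (e^-1 + sum_j e^(- 2^j)) <= e^-r. By subadditivity the links of a cost
   at most twice its approximation errors. The infimum over admissible sequences
   need not be attained a priori, so it is reached by continuity of P. *)
Require Import Defs.
From HB Require Import structures.
From mathcomp Require Import all_boot all_order all_algebra finmap.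
From mathcomp Require Import all_classical all_reals all_analysis.
From mathcomp Require Import measurable_realfun.
From mathcomp Require Import ring lra zify.

Set Implicit Arguments.
Unset Strict Implicit.
Unset Printing Implicit Defensive.

Import Order.TTheory GRing.Theory Num.Theory.
Import numFieldNormedType.Exports.

Local Open Scope classical_set_scope.
Local Open Scope ring_scope.

(** * Union bounds and continuity from below for superlevel events *)

Section measure_bounds.
Local Open Scope ereal_scope.
Context d (T : measurableType d) (R : realType)
  (mu : {measure set T -> \bar R}).

Lemma measure_fin_bigcup_le (I : choiceType) (K : set I) (E : I -> set T)
    (p : \bar R) : finite_set K -> (forall i, K i -> measurable (E i)) ->
  (forall i, K i -> mu (E i) <= p) ->
  mu (\bigcup_(i in K) E i) <= #|` fset_set K|%:R%:E * p.
Proof.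
move=> finK mE Ep.
have sE (s : seq I) : {in s, forall i, measurable (E i)} ->
    {in s, forall i, mu (E i) <= p} ->
    mu (\big[setU/set0]_(i <- s) E i) <= (size s)%:R%:E * p.
  elim: s => [|i s IH] ms ps; first by rewrite big_nil measure0 mul0e.
  have ms' : {in s, forall i, measurable (E i)}.
    by move=> j js; apply: ms; rewrite inE js orbT.
  have ps' : {in s, forall i, mu (E i) <= p}.
    by move=> j js; apply: ps; rewrite inE js orbT.
  have pi : mu (E i) <= p by apply: ps; rewrite inE eqxx.
  have p0 : 0 <= p by exact: le_trans pi.
  rewrite big_cons /= -natr1 EFinD ge0_muleDl ?lee_fin//.
  rewrite mul1e [leRHS]addeC.
  apply: le_trans (measureU2 _ _ _) _.
  - by apply: ms; rewrite inE eqxx.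
  - by rewrite big_seq; apply: bigsetU_measurable => j js; exact: ms'.
  - by apply: leeD => //; exact: IH.
rewrite -bigsetU_fset_set//; apply: sE => i; rewrite in_fset_set// inE.
- exact: mE.
- exact: Ep.
Qed.

Lemma measure_bigsetU_le (E : nat -> set T) (N : nat) :
  (forall i, measurable (E i)) ->
  mu (\big[setU/set0]_(i < N) E i) <= \sum_(i < N) mu (E i).
Proof.
move=> mE; apply: content_subadditive => //.
exact: bigsetU_measurable.
Qed.

Lemma measurable_superlevel (h : T -> R) (c : R) : measurable_fun setT h ->
  measurable [set w | (c < h w)%R].
Proof.
move=> mh; rewrite (_ : [set _ | _] = h @^-1` `]c, +oo[%classic); last first.
  by apply/seteqP; split => w /=; rewrite in_itv/= andbT.
by rewrite -[X in measurable X]setTI; exact: mh.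
Qed.

(** Continuity from below: the union at level [c] is the increasing union of those at levels
    [c + 1/(n+1)]. It lets a tail bound known strictly above an infimum pass to the infimum
    itself. *)
Lemma superlevel_bigcup_measure_le (I : choiceType) (K : set I)
    (h : I -> T -> R) (c : R) (p : \bar R) : finite_set K ->
  (forall i, K i -> measurable_fun setT (h i)) ->
  (forall v, (c < v)%R -> mu (\bigcup_(i in K) [set w | (v < h i w)%R]) <= p) ->
  mu (\bigcup_(i in K) [set w | (c < h i w)%R]) <= p.
Proof.
move=> finK mh hp; pose E v := \bigcup_(i in K) [set w | (v < h i w)%R].
have mE v : measurable (E v).
  by apply: fin_bigcup_measurable => // i Ki; exact/measurable_superlevel/mh.
pose F n := E (c + n.+1%:R^-1)%R.
have FE : E c = \bigcup_n F n.
  apply/seteqP; split => w /=; last first.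
    move=> [n _] [i Ki] /= h1; exists i => //=.
    by apply: lt_trans h1; rewrite ltrDl.
  (* With [n] the integer part of [1 / (h i w - c)], the gap [1/(n+1)] is smaller than
     [h i w - c]. *)
  move=> [i Ki] /= chw; exists (Num.truncn (h i w - c)^-1) => //.
  exists i => //=.
  rewrite -ltrBrDl invf_plt ?posrE ?subr_gt0//.
  by rewrite truncnS_gt ?invr_ge0 ?subr_ge0 ?ltW.
have ndF : nondecreasing_seq F.
  move=> m n mn; apply/subsetPset => w [i Ki] /= h1; exists i => //=.
  apply: le_lt_trans h1.
  by rewrite lerD2l lef_pV2 ?posrE// ler_nat ltnS.
have := nondecreasing_cvg_mu (mu := mu) (fun n => mE _)
  (bigcup_measurable (fun n _ => mE _)) ndF.
rewrite -/(E c) FE => /cvg_lim <- //.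
apply: lime_le.
  by apply: ereal_nondecreasing_is_cvgn => m n mn; apply: le_measure;
    rewrite ?inE//; exact/subsetPset/ndF.
by apply: nearW => n /=; apply: hp; rewrite ltrDl.
Qed.

Lemma superlevel_measure_le (h : T -> R) (c : R) (p : \bar R) :
  measurable_fun setT h ->
  (forall v, (c < v)%R -> mu [set w | (v < h w)%R] <= p) ->
  mu [set w | (c < h w)%R] <= p.
Proof.
move=> mh hp.
have := @superlevel_bigcup_measure_le _ [set tt] (fun=> h) c p.
by rewrite bigcup_set1; apply => // v cv; rewrite bigcup_set1; exact: hp.
Qed.

End measure_bounds.

(** * Conditional value at risk *)

(* By the variational formula of Rockafellar and Uryasev, this is the
   conditional value at risk of Z at tail probability e^-s. *)
Definition cvar d (T : measurableType d) (R : realType) (P : probability T R)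
    (s : R) (Z : T -> R) : \bar R :=
  ereal_inf [set (t%:E + (expR s)%:E * 'E_P[fun w => Num.max (Z w - t)%R 0%R])%E
            | t in [set: R]].

Section cvar_theory.
Local Open Scope ereal_scope.
Context d (T : measurableType d) (R : realType) (P : probability T R).
Implicit Types (Z : T -> R) (s t : R).

Let excess Z t : T -> R := fun w => Num.max (Z w - t)%R 0%R.

Let excess_ge0 Z t w : (0 <= excess Z t w)%R.
Proof. by rewrite /excess le_max lexx orbT. Qed.

Let Eexcess_ge0 Z t : 0 <= 'E_P[excess Z t].
Proof. by apply: expectation_ge0 => w; exact: excess_ge0. Qed.

Let measurable_excess Z t : measurable_fun setT Z ->
  measurable_fun setT (excess Z t).
Proof.
by move=> mZ; apply: measurable_funrpos; exact: measurable_funB.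
Qed.

Let le_expectation Z1 Z2 : measurable_fun setT Z1 -> measurable_fun setT Z2 ->
  (forall w, (0 <= Z1 w)%R) -> (forall w, (Z1 w <= Z2 w)%R) ->
  'E_P[Z1] <= 'E_P[Z2].
Proof.
move=> m1 m2 Z10 Z12; apply: expectation_le => //.
- by move=> w; exact: le_trans (Z12 w).
- exact: aeW.
Qed.

Lemma cvar_le s Z t : cvar P s Z <= t%:E + (expR s)%:E * 'E_P[excess Z t].
Proof. by apply: ereal_inf_lbound; exists t. Qed.

Lemma cvar_lty s Z : P.-integrable setT (EFin \o Z) -> cvar P s Z < +oo.
Proof.
move=> iZ; have /integrableP[/measurable_EFinP mZ Zoo] := iZ.
apply: le_lt_trans (cvar_le s Z 0%R) _; rewrite add0e.
apply: (@le_lt_trans _ _ ((expR s)%:E * 'E_P[fun w => `|Z w|%R])).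
  apply: lee_pmul => //.
  - apply: le_expectation => //.
    + exact: measurable_excess.
    + exact: measurableT_comp.
    + by move=> w; rewrite /excess subr0 ge_max normr_ge0 ler_norm.
apply: lte_mul_pinfty => //.
by rewrite unlock.
Qed.

(** For each [t], the mean of [(Z - t)_+] is at least [E(Z - t) = -t]. It is also nonnegative, so
    the factor [e^s >= 1] only increases it. *)
Lemma cvar_ge0 s Z : (0 <= s)%R -> P.-integrable setT (EFin \o Z) ->
  'E_P[Z] = 0 -> 0 <= cvar P s Z.
Proof.
move=> s0 iZ EZ0; have /integrableP[/measurable_EFinP mZ _] := iZ.
apply: le_ereal_inf_tmp => _ [t _ <-].
have iZt : P.-integrable setT (EFin \o (fun w => Z w - t)%R).
  rewrite (_ : _ \o _ = (EFin \o Z) \- cst t%:E); last by [].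
  by apply: integrableB => //; exact: finite_measure_integrable_cst.
have h : - t%:E <= 'E_P[excess Z t].
  have -> : - t%:E = 'E_P[fun w => (Z w - t)%R].
    have -> : (fun w => Z w - t)%R = (Z \- cst t)%R by [].
    rewrite expectationB ?EZ0 ?expectation_cst ?sub0e//.
    - exact/Lfun1_integrable.
    - apply/Lfun1_integrable; exact: finite_measure_integrable_cst.
  have mt : measurable_fun setT (excess Z t) by exact: measurable_excess.
  rewrite unlock integralE.
  apply: (@le_trans _ _ (\int[P]_w (EFin \o (fun w => Z w - t)%R)^\+ w)).
    rewrite leeBlDr; last first.
      by apply: integrable_neg_fin_num => //.
    by rewrite leeDl// integral_ge0.
  apply: ge0_le_integral => //.
  - apply: measurable_funepos; exact: (measurable_int _ iZt).
  - exact/measurable_EFinP.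
  - by move=> w _; rewrite funeposE /= EFin_max.
apply: (@le_trans _ _ (t%:E + 'E_P[excess Z t])).
  by have := leeD2l t%:E h; rewrite subee.
rewrite leeD2l// lee_pemull//.
by rewrite lee_fin; have := expR_ge1Dx s; apply: le_trans; rewrite lerDl.
Qed.

Lemma cvar_fin_num s Z : (0 <= s)%R -> P.-integrable setT (EFin \o Z) ->
  'E_P[Z] = 0 -> cvar P s Z \is a fin_num.
Proof.
move=> s0 iZ EZ; rewrite ge0_fin_numE; first exact: cvar_lty.
exact: cvar_ge0.
Qed.

Lemma le_cvar s1 s2 Z : (s1 <= s2)%R -> cvar P s1 Z <= cvar P s2 Z.
Proof.
move=> s12; apply: le_ereal_inf_tmp => _ [t _ <-].
apply: le_trans (cvar_le s1 Z t) _; rewrite leeD2l// lee_wpmul2r//.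
by rewrite lee_fin ler_expR.
Qed.

(** Pointwise, [(Z1 + Z2 - t1 - t2)_+ <= (Z1 - t1)_+ + (Z2 - t2)_+]. Choosing each [t] optimal up to
    [e / 2] avoids attainment of the infima. *)
Lemma cvarD s Z1 Z2 : measurable_fun setT Z1 -> measurable_fun setT Z2 ->
  cvar P s Z1 \is a fin_num -> cvar P s Z2 \is a fin_num ->
  cvar P s (fun w => Z1 w + Z2 w)%R <= cvar P s Z1 + cvar P s Z2.
Proof.
move=> m1 m2 f1 f2.
have split t1 t2 : cvar P s (fun w => Z1 w + Z2 w)%R <=
    (t1%:E + (expR s)%:E * 'E_P[excess Z1 t1]) +
    (t2%:E + (expR s)%:E * 'E_P[excess Z2 t2]).
  apply: le_trans (cvar_le s _ (t1 + t2)%R) _.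
  rewrite addeACA -EFinD leeD2l// -ge0_muleDr //.
  rewrite lee_wpmul2l ?lee_fin ?expR_ge0//.
  have -> : 'E_P[excess Z1 t1] + 'E_P[excess Z2 t2] =
            'E_P[excess Z1 t1 \+ excess Z2 t2].
    rewrite unlock -ge0_integralD//.
    - by move=> w _; rewrite lee_fin.
    - exact/measurable_EFinP/measurable_excess.
    - by move=> w _; rewrite lee_fin.
    - exact/measurable_EFinP/measurable_excess.
  apply: le_expectation => //.
  - by apply: measurable_excess; exact: measurable_funD.
  - by apply: measurable_funD; exact: measurable_excess.
  - move=> w; rewrite /excess /= ge_max addr_ge0 ?excess_ge0// andbT.
    by rewrite opprD addrACA lerD// le_max lexx.
apply/lee_addgt0Pr => e e0.
have e20 : (0 < e / 2)%R by rewrite divr_gt0.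
have [_ [t1 _ <-] lt1] := lb_ereal_inf_adherent e20 f1.
have [_ [t2 _ <-] lt2] := lb_ereal_inf_adherent e20 f2.
apply: le_trans (split t1 t2) _.
apply: le_trans (leeD (ltW lt1) (ltW lt2)) _.
by rewrite addeACA -EFinD -splitr.
Qed.

(** Let [v] exceed the infimum and suppose [P(Z > v) > e^-s]. A candidate with [t >= v] is at least
    [v]. For [t < v], Markov's inequality gives [E(Z - t)_+ >= (v - t) e^-s], so the candidate is
    again at least [t + (v - t) = v], a contradiction. Continuity of [P] then lets [v] decrease to
    the infimum. *)
Lemma cvar_tail s Z : (0 <= s)%R -> P.-integrable setT (EFin \o Z) ->
  'E_P[Z] = 0 ->
  P [set w | cvar P s Z < (Z w)%:E] <= (expR (- s))%:E.
Proof.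
move=> s0 iZ EZ; have fT := cvar_fin_num s0 iZ EZ.
have /integrableP[/measurable_EFinP mZ _] := iZ.
have -> : [set w | cvar P s Z < (Z w)%:E] =
          [set w | (fine (cvar P s Z) < Z w)%R].
  by apply: eq_set => w; rewrite -{1}(fineK fT) lte_fin.
apply: superlevel_measure_le => // v.
rewrite -lte_fin fineK// => Tv; rewrite leNgt; apply/negP => Pv.
move: Tv; apply/negP; rewrite -leNgt; apply: le_ereal_inf_tmp => _ [t _ <-].
have [vt|tv] := leP v t.
  apply: (@le_trans _ _ t%:E); first by rewrite lee_fin.
  by rewrite leeDl//; apply: mule_ge0 => //; exact: Eexcess_ge0.
set E := [set w | (v < Z w)%R] in Pv.
have mE : measurable E by exact: measurable_superlevel.
have ivt : (v - t)%:E * P E <= 'E_P[excess Z t].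
  have -> : (v - t)%:E * P E = 'E_P[fun w => (v - t) * \1_E w]%R.
    rewrite unlock; under eq_integral do rewrite EFinM.
    rewrite ge0_integralZl//; first by rewrite integral_indic// setIT.
      exact/measurable_EFinP.
    by rewrite lee_fin subr_ge0 ltW.
  apply: le_expectation.
  - by apply: measurable_funM => //.
  - exact: measurable_excess.
  - by move=> w; rewrite mulr_ge0// subr_ge0 ltW.
  - move=> w; rewrite /excess indicE; have [wE|_] := boolP (w \in E).
      rewrite mulr1 le_max lerB ?orTb//.
      by move: wE; rewrite inE /E /= => /ltW.
    by rewrite mulr0 le_max lexx orbT.
have h : (v - t)%:E <= (expR s)%:E * ((v - t)%:E * P E).
  rewrite muleCA -[leLHS]mule1; apply: lee_wpmul2l.
    by rewrite lee_fin subr_ge0 ltW.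
  apply: (@le_trans _ _ ((expR s)%:E * (expR (- s))%:E)).
    by rewrite -EFinM -expRD subrr expR0.
  by apply: lee_wpmul2l; [rewrite lee_fin expR_ge0|exact: ltW].
have -> : v%:E = t%:E + (v - t)%:E by rewrite -EFinD addrC subrK.
by rewrite leeD2l//; apply: (le_trans h); apply: lee_wpmul2l.
Qed.

End cvar_theory.

(** * Empirical means of centered functions *)

Section empirical_mean.
Context d d' (Omega : measurableType d) (S : measurableType d') (R : realType)
  (P : probability Omega R) (X : {mfun Omega >-> S}) (n : nat)
  (Xs : 'I_n -> {mfun Omega >-> S}).
Implicit Types (f g h : S -> R) (s : R).

Lemma emp_meanB g h w :
  emp_mean Xs (g \- h) w = emp_mean Xs g w - emp_mean Xs h w.
Proof. by rewrite /emp_mean -mulrBr -sumrB. Qed.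

Lemma centered_integrableB g h : centered_integrable P X g ->
  centered_integrable P X h -> centered_integrable P X (g \- h).
Proof.
move=> [mg ig eg] [mh ih eh]; split.
- exact: measurable_funB.
- rewrite (_ : _ \o _ = ((EFin \o (g \o X)) \- (EFin \o (h \o X)))%E)//.
  exact: integrableB.
- rewrite (_ : _ \o _ = (g \o X) \- (h \o X))//.
  by rewrite expectationB ?eg ?eh ?sube0//; exact/Lfun1_integrable.
Qed.

Lemma centered_integrable0 : centered_integrable P X (cst 0).
Proof.
split; first exact: measurable_cst.
- exact: finite_measure_integrable_cst.
- exact: expectation_cst.
Qed.

Lemma centered_integrableN g : centered_integrable P X g ->
  centered_integrable P X (\- g).
Proof.
move=> Vg; rewrite (_ : \- g = cst 0 \- g).
  exact: (centered_integrableB centered_integrable0).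
by apply/funext => x /=; rewrite sub0r.
Qed.

Hypothesis same_law : forall i (E : set S), measurable E ->
  distribution P (Xs i) E = distribution P X E.

Lemma centered_integrable_copy g i : centered_integrable P X g ->
  centered_integrable P (Xs i) g.
Proof.
move=> [mg ig eg]; have mEg : measurable_fun setT (EFin \o g).
  exact/measurable_EFinP.
have igi : P.-integrable setT (EFin \o (g \o Xs i)).
  apply/integrableP; split.
    by apply/measurable_EFinP; exact: measurableT_comp.
  have /integrableP[_] := ig; apply: le_lt_trans.
  have abs_law (Y : {mfun Omega >-> S}) :
      (\int[P]_w `|(EFin \o (g \o Y)) w| =
       \int[distribution P Y]_x `|(EFin \o g) x|)%E.
    by rewrite ge0_integral_distribution//; exact: measurableT_comp.
  by rewrite !abs_law (eq_measure_integral (distribution P X))// => E mE _;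
     exact: same_law.
split => //; move: eg; rewrite unlock => <-.
have -> : (\int[P]_w ((g \o Xs i) w)%:E =
           \int[distribution P (Xs i)]_x (EFin \o g) x)%E.
  by rewrite integral_distribution.
have -> : (\int[P]_w ((g \o X) w)%:E =
           \int[distribution P X]_x (EFin \o g) x)%E.
  by rewrite integral_distribution.
by apply: eq_measure_integral => E mE _; exact: same_law.
Qed.

Lemma measurable_emp_mean g : measurable_fun setT g ->
  measurable_fun setT (emp_mean Xs g).
Proof.
move=> mg; apply: measurable_funM => //.
by apply: measurable_sum => i; exact: measurableT_comp.
Qed.

Lemma emp_mean_centered g : centered_integrable P X g ->
  P.-integrable setT (EFin \o emp_mean Xs g) /\ ('E_P[emp_mean Xs g] = 0)%E.
Proof.
move=> Vg; have Vi i := centered_integrable_copy i Vg.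
have gL i : (g \o Xs i) \in Lfun P 1.
  by have [_ ? _] := Vi i; apply/Lfun1_integrable.
have -> : emp_mean Xs g =
    n%:R^-1 \o* (\sum_(Y <- [seq g \o Xs i | i : 'I_n]) Y).
  apply/funext => w; rewrite /emp_mean /= fct_sumE big_map mulrC.
  by rewrite -(big_enum _ _ xpredT).
have sL : (\sum_(Y <- [seq g \o Xs i | i : 'I_n]) Y) \in Lfun P 1.
  by rewrite big_map rpred_sum// => i _.
split.
  apply/Lfun1_integrable.
  have -> : forall Y : Omega -> R, n%:R^-1 \o* Y = n%:R^-1 *: Y.
    by move=> Y; apply/funext => w; rewrite /= mulrC.
  exact: rpredZ.
rewrite expectationZl// expectation_sum; last first.
  by move=> Y /mapP[i _ ->].
rewrite big_map big1 ?mule0// => i _.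
by have [_ _] := Vi i.
Qed.
End empirical_mean.

(** * Tail bound and subadditivity for [Tsharp] *)

Section Tsharp_theory.
Local Open Scope ereal_scope.
Context d d' (Omega : measurableType d) (S : measurableType d') (R : realType)
  (P : probability Omega R) (X : {mfun Omega >-> S}) (n : nat)
  (Xs : 'I_n -> {mfun Omega >-> S}).
Hypothesis same_law : forall i (E : set S), measurable E ->
  distribution P (Xs i) E = distribution P X E.
Implicit Types (f g h : S -> R) (s : R).
Local Notation V := (centered_integrable P X).

Lemma Tsharp_cvar s g : Tsharp P Xs s g = cvar P s (emp_mean Xs g).
Proof. by []. Qed.

Lemma Tsharp_ge0 s g : (0 <= s)%R -> V g -> 0 <= Tsharp P Xs s g.
Proof. by move=> s0 /(emp_mean_centered same_law)[ig eg]; exact: cvar_ge0. Qed.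

Lemma Tsharp_fin_num s g : (0 <= s)%R -> V g -> Tsharp P Xs s g \is a fin_num.
Proof.
by move=> s0 /(emp_mean_centered same_law)[ig eg]; exact: cvar_fin_num.
Qed.

Lemma Tsharp_tail s g : (0 <= s)%R -> V g ->
  P [set w | Tsharp P Xs s g < (emp_mean Xs g w)%:E] <= (expR (- s))%:E.
Proof. by move=> s0 /(emp_mean_centered same_law)[ig eg]; exact: cvar_tail. Qed.

Lemma measurable_exceedance s g : measurable_fun setT g ->
  measurable [set w | Tsharp P Xs s g < (emp_mean Xs g w)%:E].
Proof.
move=> mg; rewrite -[X in measurable X]setTI; apply: measurable_lte => //.
by apply/measurable_EFinP; exact: measurable_emp_mean.
Qed.

Lemma Tsharp_bar_ge s g : Tsharp P Xs s g <= Tsharp_bar P Xs s g.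
Proof. by rewrite /Tsharp_bar le_max lexx. Qed.

Lemma Tsharp_bar_ge0 s g : (0 <= s)%R -> V g -> 0 <= Tsharp_bar P Xs s g.
Proof.
by move=> s0 Vg; apply: le_trans (Tsharp_bar_ge s g); exact: Tsharp_ge0.
Qed.

Lemma Tsharp_bar_fin_num s g : (0 <= s)%R -> V g ->
  Tsharp_bar P Xs s g \is a fin_num.
Proof.
move=> s0 Vg; rewrite /Tsharp_bar maxEle; case: ifP => _.
  by apply: Tsharp_fin_num => //; exact: centered_integrableN.
exact: Tsharp_fin_num.
Qed.

Lemma le_Tsharp_bar s1 s2 g : (s1 <= s2)%R ->
  Tsharp_bar P Xs s1 g <= Tsharp_bar P Xs s2 g.
Proof.
move=> s12; rewrite /Tsharp_bar ge_max !le_max.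
by rewrite !(le_cvar P _ s12) orbT.
Qed.

(** The candidate [t = 0] has value zero. This makes the approximation error at the end of a chain
    vanish. *)
Lemma Tsharp_bar_subrr s g : Tsharp_bar P Xs s (g \- g)%R <= 0.
Proof.
have T0 f : (forall w, emp_mean Xs f w = 0%R) -> Tsharp P Xs s f <= 0.
  move=> f0; apply: le_trans (cvar_le P s (emp_mean Xs f) 0%R) _.
  rewrite (_ : (fun _ => _) = cst 0%R) ?expectation_cst ?mule0 ?adde0//.
  by apply/funext => w; rewrite f0 subr0 maxxx.
rewrite /Tsharp_bar ge_max; apply/andP; split; apply: T0 => w.
  by rewrite emp_meanB subrr.
by rewrite /emp_mean big1 ?mulr0// => i _; rewrite /= subrr oppr0.
Qed.

(** Subadditivity applied to [g] and [-h]; the two-sided quantity on the right absorbs the change of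
    sign. *)
Lemma TsharpB s g h : (0 <= s)%R -> V g -> V h ->
  Tsharp P Xs s (g \- h)%R <= Tsharp_bar P Xs s g + Tsharp_bar P Xs s h.
Proof.
move=> s0 Vg Vh; have VNh := centered_integrableN Vh.
apply: (@le_trans _ _ (Tsharp P Xs s g + Tsharp P Xs s (\- h)%R)).
  rewrite !Tsharp_cvar.
  have -> : emp_mean Xs (g \- h)%R =
            (fun w => emp_mean Xs g w + emp_mean Xs (\- h)%R w)%R.
    apply/funext => w; rewrite emp_meanB /emp_mean; congr (_ + _)%R.
    by rewrite -mulrN sumrN.
  have [mg _ _] := Vg; have [mNh _ _] := VNh.
  apply: cvarD; rewrite -?Tsharp_cvar ?Tsharp_fin_num//;
    exact: measurable_emp_mean.
by apply: leeD; [exact: Tsharp_bar_ge|rewrite /Tsharp_bar le_max lexx orbT].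
Qed.

End Tsharp_theory.

(** * Numerical estimates for the union bounds *)

Section exp_bounds.
Context (R : realType).

(** From [e >= (1 + 1/16)^16], evaluated by four squarings with the values rounded down. The
    constant [19/50] lies just below [(3 - sqrt 5)/2], the threshold that the next bound needs. *)
Lemma expRN1_le : expR (- 1) <= 19 / 50 :> R.
Proof.
have e16 : 17 / 16 <= expR (16^-1) :> R.
  by apply: le_trans (expR_ge1Dx _); lra.
have -> : expR (- 1) = (expR (16^-1) ^+ 16)^-1 :> R.
  by rewrite -expRM_natl divff// expRN.
set y : R := expR _ in e16 *.
have sq (a b : R) : 0 <= a -> a <= b -> a ^+ 2 <= b ^+ 2.
  by move=> a0 ab; rewrite lerXn2r// nnegrE; lra.
have y2 : 289 / 256 <= y ^+ 2.
  by apply: le_trans (sq _ _ _ e16); lra.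
have y4 : 637 / 500 <= y ^+ 4.
  by rewrite (exprM y 2 2); apply: le_trans (sq _ _ _ y2); lra.
have y8 : 1623 / 1000 <= y ^+ 8.
  by rewrite (exprM y 4 2); apply: le_trans (sq _ _ _ y4); lra.
have y16 : 50 / 19 <= y ^+ 16.
  by rewrite (exprM y 8 2); apply: le_trans (sq _ _ _ y8); lra.
by rewrite invf_ple ?posrE; lra.
Qed.

(** Since [2^j >= j + 1], the sum is dominated by the geometric series of ratio [q = e^-1]. The
    total [q + q/(1 - q)] is at most 1 as soon as [q^2 - 3q + 1 >= 0]. *)
Lemma sum_expRN_exp2_le N : expR (- 1) + \sum_(j < N) expR (- 2 ^+ j) <= 1 :> R.
Proof.
have := expRN1_le; set q : R := expR (- 1) => q38.
have q0 : 0 < q by exact: expR_gt0.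
have S : (\sum_(j < N) expR (- 2 ^+ j)) * (1 - q) <= q - q ^+ N.+1.
  elim: N => [|N IH]; first by rewrite big_ord0 mul0r expr1 subrr.
  have : expR (- 2 ^+ N) <= q ^+ N.+1.
    rewrite -expRM_natl ler_expR mulrN1 lerN2 -natrX ler_nat.
    exact: ltn_expl.
  rewrite big_ord_recr /= [q ^+ N.+2]exprS => h.
  move: IH h; set a := \sum_(_ < _) _; set b := expR (- 2 ^+ N).
  set c := q ^+ N.+1.
  nra.
have qN : 0 < q ^+ N.+1 by rewrite exprn_gt0.
move: S qN; set a := \sum_(_ < _) _; set c := q ^+ N.+1.
nra.
Qed.

Lemma exp2_le_expR (k : nat) : (2 ^ k)%:R <= expR k%:R :> R.
Proof.
rewrite natrX -[k%:R in leRHS]mulr1 expRM_natl.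
rewrite lerXn2r ?nnegrE ?expR_ge0//.
by have := expR_ge1Dx (1 : R).
Qed.

(** This is [2^m = 2^l * 2^j] with [2^l <= x]. Taking logarithms accommodates a negative [l]. *)
Lemma exp2_floor_log2_le (x : R) (l : int) (j m : nat) : 0 < x ->
  l%:~R <= ln x / ln 2 -> l + j%:Z = m%:Z -> 2 ^+ m <= x * 2 ^+ j.
Proof.
move=> x0 lx ljm.
have ln20 : 0 < ln 2 :> R by rewrite ln_gt0// ltr1n.
rewrite -ler_ln ?posrE ?exprn_gt0 ?mulr_gt0 ?exprn_gt0//.
rewrite lnM ?posrE ?exprn_gt0// !lnXn//.
move: lx; rewrite ler_pdivlMr// => lx.
have -> : ln 2 *+ m = l%:~R * ln 2 + ln 2 *+ j :> R.
  have -> : l%:~R = m%:R - j%:R :> R.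
    by rewrite -[m%:R]/(m%:Z%:~R) -ljm intrD addrK.
  by rewrite mulrBl !mulr_natl subrK.
by rewrite lerD2r.
Qed.

End exp_bounds.

(** * Nearest points and admissible sequences *)

Lemma finite_set_argmin (I : choiceType) (R : realType) (K : set I)
    (f : I -> \bar R) : finite_set K -> K !=set0 ->
  exists2 i, K i & forall j, K j -> (f i <= f j)%E.
Proof.
move=> finK [i0 Ki0].
have seq_min (s : seq I) x : exists2 y, y \in x :: s &
    {in x :: s, forall z, (f y <= f z)%E}.
  elim: s x => [|a s IH] x.
    by exists x; rewrite ?inE// => z; rewrite inE => /eqP ->.
  have [y yin ymin] := IH a; have [xy|/ltW yx] := leP (f x) (f y).
    exists x; first by rewrite inE eqxx.
    move=> z; rewrite inE => /predU1P[->//|/ymin]; exact: le_trans.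
  exists y; first by rewrite inE yin orbT.
  by move=> z; rewrite inE => /predU1P[->//|/ymin].
have [y yin ymin] := seq_min (fset_set K) i0.
exists y.
  move: yin; rewrite inE => /predU1P[->//|].
  by rewrite in_fset_set// inE.
by move=> j Kj; apply: ymin; rewrite inE in_fset_set// mem_set// orbT.
Qed.

Section admissible_theory.
Context (S : Type) (R : realType) (calA : set (S -> R)).
Hypothesis finA : finite_set calA.
Implicit Types (B : nat -> set (S -> R)) (l : int).

Lemma admissible_mem0 B : admissible calA B -> calA (cst 0).
Proof. by move=> [BA _ B0 _]; apply: (BA 0%N); rewrite B0. Qed.

Lemma int_level_sub B l : admissible calA B -> int_level B l `<=` calA.
Proof.
move=> adB; case: l => [m|m] /=; first by have [BA _ _ _] := adB; exact: BA.
by move=> _ ->; exact: admissible_mem0 adB.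
Qed.

Lemma int_level_mem0 B l : admissible calA B -> int_level B l (cst 0).
Proof.
by case: l => [m|m] //= [_ ndB B0 _]; apply: (ndB 0%N) => //; rewrite B0.
Qed.

Lemma finite_int_level B l : admissible calA B -> finite_set (int_level B l).
Proof. by move=> adB; exact: sub_finite_set (int_level_sub adB) finA. Qed.

Lemma card_int_level B (m : nat) : admissible calA B ->
  (#|` fset_set (int_level B m%:Z)| <= 2 ^ (2 ^ m))%N.
Proof.
move=> [_ _ B0 cB]; case: m => [|m] /=; first by rewrite B0 fset_set1 cardfs1.
by apply: geq_card_fset_set; exact: cB.
Qed.

Lemma card_int_level_npos B l : admissible calA B -> l <= 0 ->
  #|` fset_set (int_level B l)| = 1%N.
Proof.
move=> [_ _ B0 _]; case: l => [[|m]|m] //= _; last by rewrite fset_set1 cardfs1.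
by rewrite B0 fset_set1 cardfs1.
Qed.

(* Completing an admissible sequence only decreases its approximation errors,
   and it makes every chain finite. *)
Definition completed B : nat -> set (S -> R) :=
  fun i => if (#|` fset_set calA| < i)%N then calA else B i.

Lemma completed_admissible B : admissible calA B ->
  admissible calA (completed B).
Proof.
move=> [BA ndB B0 cB]; split => //.
- by move=> i; rewrite /completed; case: ifP => // _; exact: subset_refl.
- move=> i j ij; rewrite /completed; case: ifP => [li|_].
    by rewrite (leq_trans li ij); exact: subset_refl.
  by case: ifP => // _; exact: ndB.
- move=> i i1; rewrite /completed; case: ifP => [li|_]; last exact: cB.
  (* Here [#|calA| < i < 2^i < 2^(2^i)], so the replaced set still meets the cardinality
     constraint. *)
  apply: (@card_le_trans _ _ _ `I_#|` fset_set calA|).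
    have : ([set` fset_set calA] #= `I_#|` fset_set calA|)%card.
      exact/card_eq_fsetP.
    by rewrite fset_setK// card_eq_le => /andP[].
  rewrite card_le_II.
  apply: (leq_trans (ltnW li)); apply: (@leq_trans (2 ^ i)).
    by rewrite ltnW// ltn_expl.
  by rewrite ltnW// ltn_expl.
Qed.

Lemma int_level_completed_sup B l : int_level B l `<=` calA ->
  int_level B l `<=` int_level (completed B) l.
Proof.
case: l => [m|m] /= sub x Bx; rewrite /completed//.
by case: ifP => // _; exact: sub.
Qed.

Lemma int_level_completed_eq B m : (#|` fset_set calA| < m)%N ->
  int_level (completed B) m%:Z = calA.
Proof. by rewrite /= /completed => ->. Qed.

End admissible_theory.

(** * Generic chaining along one admissible sequence *)

Section chaining.
Context d d' (Omega : measurableType d) (S : measurableType d') (R : realType)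
  (P : probability Omega R) (X : {mfun Omega >-> S}) (n : nat)
  (Xs : 'I_n -> {mfun Omega >-> S}).
Hypothesis same_law : forall i (E : set S), measurable E ->
  distribution P (Xs i) E = distribution P X E.
Local Notation V := (centered_integrable P X).

(** The map [G] lets the index be either the function itself or one endpoint [y] of a link [x - y]
    with [x] fixed. *)
Lemma exceedance_bigcup_le (K : set (S -> R)) (G : (S -> R) -> S -> R) (s : R) :
  0 <= s -> finite_set K -> (forall g, K g -> V (G g)) ->
  measurable (\bigcup_(g in K)
    [set w | (Tsharp P Xs s (G g) < (emp_mean Xs (G g) w)%:E)%E]) /\
  (P (\bigcup_(g in K)
     [set w | (Tsharp P Xs s (G g) < (emp_mean Xs (G g) w)%:E)%E]) <=
   (#|` fset_set K|%:R * expR (- s))%:E)%E.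
Proof.
move=> s0 finK KV.
have mE g : K g -> measurable
    [set w | (Tsharp P Xs s (G g) < (emp_mean Xs (G g) w)%:E)%E].
  by move=> Kg; apply: measurable_exceedance; have [] := KV _ Kg.
split; first exact: fin_bigcup_measurable.
rewrite EFinM; apply: measure_fin_bigcup_le => // g Kg.
by apply: Tsharp_tail same_law _ _ s0 (KV _ Kg).
Qed.

Context (calA : set (S -> R)) (r : R) (l0 : int) (B : nat -> set (S -> R))
  (N : nat).
Hypotheses (r0 : 0 < r) (l0r : l0%:~R <= ln (r / 3) / ln 2).
Hypotheses (finA : finite_set calA) (AV : calA `<=` V).
Hypotheses (adB : admissible calA B) (BN : int_level B (l0 + N%:Z) = calA).

Let D (j : nat) := int_level B (l0 + j%:Z).
Let s (j : nat) : R := r + (r + 1) * 2 ^+ j.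

Let s_ge0 j : 0 <= s j.
Proof. by rewrite addr_ge0 ?mulr_ge0 ?addr_ge0 ?exprn_ge0// ltW. Qed.

Let finD j : finite_set (D j).
Proof. exact: (finite_int_level finA _ adB). Qed.

Let DV j : D j `<=` V.
Proof. exact: subset_trans (int_level_sub adB) AV. Qed.

Let level_le j m : l0 + j%:Z = m%:Z -> 3 * 2 ^+ m <= r * 2 ^+ j.
Proof.
have r3 : 0 < r / 3 by rewrite divr_gt0.
move=> /(exp2_floor_log2_le r3 l0r) h.
by rewrite mulrC -ler_pdivlMr// mulrAC.
Qed.

Let card_start : #|` fset_set (D 0)|%:R <= expR r.
Proof.
case E : (l0 + 0%:Z) => [m|m].
  apply: (@le_trans _ _ (2 ^ (2 ^ m))%:R).
    by rewrite ler_nat /D E; exact: card_int_level adB.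
  apply: (le_trans (exp2_le_expR _ _)); rewrite ler_expR natrX.
  have := level_le E; rewrite expr0 mulr1; apply: le_trans.
  by rewrite ler_peMl ?exprn_ge0// ler1n.
rewrite /D E (card_int_level_npos adB)//.
by rewrite -(expR0 R) ler_expR ltW.
Qed.

(* With [m = l0 + j] the cardinality is at most
   [2 ^ (2 ^ (m + 1)) * 2 ^ (2 ^ m) = 2 ^ (3 * 2 ^ m)], which is where the
   factor 3 in the definition of [l0] comes from. *)
Let card_link j :
  #|` fset_set (D j.+1)|%:R * #|` fset_set (D j)|%:R <= expR (r * 2 ^+ j).
Proof.
have lS : l0 + j.+1%:Z = l0 + j%:Z + 1 by rewrite -addn1 PoszD addrA.
rewrite -natrM /D lS; case E : (l0 + j%:Z) => [m|m].
  rewrite -PoszD addn1; apply: (@le_trans _ _ (2 ^ (3 * 2 ^ m))%:R).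
    rewrite ler_nat.
    apply: leq_trans (leq_mul (card_int_level _ adB) (card_int_level _ adB)) _.
    by rewrite -expnD leq_exp2l// expnS -mulSnr.
  apply: (le_trans (exp2_le_expR _ _)); rewrite ler_expR natrM natrX.
  exact: level_le.
(* A negative level [l0 + j] has successor at most 0, so both sets are reduced to the zero
   function. *)
rewrite !(card_int_level_npos adB)//.
by rewrite -(expR0 R) ler_expR mulr_ge0 ?exprn_ge0// ltW.
Qed.

Let start := \bigcup_(x in D 0)
  [set w | (Tsharp P Xs (2 * r + 1) x < (emp_mean Xs x w)%:E)%E].

Let link j := \bigcup_(x in D j.+1) \bigcup_(y in D j)
  [set w | (Tsharp P Xs (s j) (x \- y)%R < (emp_mean Xs (x \- y)%R w)%:E)%E].

Let link_le j : measurable (link j) /\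
  (P (link j) <= (expR (- r) * expR (- 2 ^+ j))%:E)%E.
Proof.
have linkx x (Dx : D j.+1 x) := @exceedance_bigcup_le (D j) (fun y => x \- y)
  (s j) (s_ge0 j) (finD j)
  (fun y Dy => centered_integrableB (DV Dx) (DV Dy)).
split.
  by apply: fin_bigcup_measurable => // x Dx; have [] := linkx x Dx.
apply: le_trans (measure_fin_bigcup_le (finD _)
  (fun x Dx => (linkx x Dx).1) (fun x Dx => (linkx x Dx).2)) _.
rewrite -EFinM lee_fin mulrA.
apply: le_trans (ler_wpM2r (expR_ge0 _) (card_link j)) _.
(* The exponents add up to [r 2^j - (r + (r + 1) 2^j) = - r - 2^j]. *)
by rewrite -!expRD ler_expR /s; lra.
Qed.

Let start_le : measurable start /\ (P start <= (expR (- r) * expR (- 1))%:E)%E.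
Proof.
have s0 : 0 <= 2 * r + 1 by rewrite addr_ge0// mulr_ge0// ltW.
have [mE PE] := @exceedance_bigcup_le (D 0) id _ s0 (finD 0) (@DV 0).
split => //; apply: (le_trans PE); rewrite lee_fin.
apply: le_trans (ler_wpM2r (expR_ge0 _) card_start) _.
by rewrite -!expRD ler_expR; lra.
Qed.

Let bad := start `|` \big[setU/set0]_(j < N) link j.

Let bad_le : measurable bad /\ (P bad <= (expR (- r))%:E)%E.
Proof.
have mlinks : measurable (\big[setU/set0]_(j < N) link j).
  by apply: bigsetU_measurable => j _; have [] := link_le j.
split; first by apply: measurableU => //; have [] := start_le.
apply: le_trans (measureU2 _ _ _) _ => //; first by have [] := start_le.
apply: (@le_trans _ _ ((expR (- r) * expR (- 1))%:E +
    \sum_(j < N) (expR (- r) * expR (- 2 ^+ j))%:E)%E).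
  apply: leeD; first by have [] := start_le.
  apply: le_trans (measure_bigsetU_le _ _ _) _.
    by move=> j; have [] := link_le j.
  by apply: lee_sum => j _; have [] := link_le j.
rewrite sumEFin -EFinD lee_fin -mulr_sumr -mulrDr.
by rewrite ler_piMr ?expR_ge0// sum_expRN_exp2_le.
Qed.

Lemma chaining : exists bad : set Omega,
  [/\ measurable bad, (P bad <= (expR (- r))%:E)%E &
   forall w, ~ bad w -> forall a, calA a ->
   ((emp_mean Xs a w)%:E <=
    mine (2%:E * Tsharp_bar P Xs (2 * r + 1) a)
         (rad_sharp P Xs (2 * r + 1) calA)
    + 2%:E * \sum_(0 <= j < N)
        rho_sharp P Xs (r + (r + 1) * 2 ^+ j)%R a (int_level B (l0 + j%:Z)))%E].
Proof.
exists bad; split; [exact: bad_le.1|exact: bad_le.2|move=> w nbad a Aa].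
have Va : V a by exact: AV.
have argmin j : exists p, D j p /\
    (Tsharp_bar P Xs (s j) (a \- p)%R <= rho_sharp P Xs (s j) a (D j))%E.
  have D0 : D j !=set0 by exists (cst 0); exact: int_level_mem0 adB.
  have [p Dp pmin] := finite_set_argmin
    (fun p => Tsharp_bar P Xs (s j) (a \- p)%R) (finD j) D0.
  by exists p; split => //; apply: le_ereal_inf_tmp => _ [q Dq <-]; exact: pmin.
have [p pP] := choice argmin.
(* The chain follows nearest points and is forced to end at [a] itself, which is legitimate because
   level [N] is all of [calA]. *)
pose u j := if (j < N)%N then p j else a.
have Du j : (j <= N)%N -> D j (u j).
  rewrite leq_eqVlt /u => /predU1P[->|jN]; last by rewrite jN; have [] := pP j.
  by rewrite ltnn /D BN.
have Vu j : (j <= N)%N -> V (u j) by move=> /Du; exact: DV.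
pose delta j := fine (Tsharp_bar P Xs (s j) (a \- u j)%R).
have deltaE j : (j <= N)%N ->
    Tsharp_bar P Xs (s j) (a \- u j)%R = (delta j)%:E.
  move=> jN; rewrite fineK//; apply: (Tsharp_bar_fin_num same_law) => //.
  exact: centered_integrableB (Vu _ _).
have delta_ge0 j : (j <= N)%N -> 0 <= delta j.
  move=> jN; rewrite -lee_fin -deltaE//; apply: (Tsharp_bar_ge0 same_law) => //.
  exact: centered_integrableB (Vu _ _).
have step j : (j < N)%N ->
    emp_mean Xs (u j.+1) w - emp_mean Xs (u j) w <= delta j + delta j.+1.
  move=> jN; rewrite -emp_meanB -lee_fin.
  apply: (@le_trans _ _ (Tsharp P Xs (s j) (u j.+1 \- u j)%R)).
    rewrite leNgt; apply/negP => h; apply: nbad; right.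
    rewrite -bigcup_mkord; exists j => //.
    by exists (u j.+1); [exact: Du|exists (u j) => //; exact/Du/ltnW].
  (* A link is a difference of two approximation errors. The second is then raised from level [s j]
     to [s j.+1] by monotonicity. *)
  rewrite (_ : u j.+1 \- u j = (a \- u j) \- (a \- u j.+1)); last first.
    by apply/funext => x /=; ring.
  apply: le_trans (TsharpB same_law _ _ _) _ => //.
  - exact: centered_integrableB (Vu _ (ltnW _)).
  - exact: centered_integrableB (Vu _ _).
  rewrite EFinD -!deltaE//; last exact: ltnW.
  apply: leeD => //; apply: le_Tsharp_bar.
  rewrite /s lerD2l; apply: ler_wpM2l; first by rewrite addr_ge0// ltW.
  by rewrite ler_weXn2l// ler1n.
(* In the telescoping sum interior errors count twice and the two ends once. The term [- delta 0] is
   kept to pay for replacing the starting point by [a]. *)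
have partial j : (j <= N)%N -> emp_mean Xs (u j) w - emp_mean Xs (u 0%N) w <=
    2 * (\sum_(i < j) delta i) + delta j - delta 0%N.
  elim: j => [|j IH] jN; first by rewrite big_ord0; lra.
  have := IH (ltnW jN); have := step j jN; rewrite big_ord_recr /=; lra.
have deltaN : delta N = 0.
  apply/le_anti; rewrite delta_ge0// andbT -lee_fin -deltaE// /u ltnn.
  exact: Tsharp_bar_subrr.
have sumE : (\sum_(i < N) delta i)%:E =
    (\sum_(i < N) Tsharp_bar P Xs (s i) (a \- u i)%R)%E.
  by rewrite -sumEFin; apply: eq_bigr => i _; rewrite deltaE// ltnW.
have first : ((emp_mean Xs (u 0%N) w)%:E <= Tsharp P Xs (2 * r + 1) (u 0%N))%E.
  rewrite leNgt; apply/negP => h; apply: nbad; left.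
  by exists (u 0%N) => //; exact: Du.
have s0E : s 0%N = 2 * r + 1 by rewrite /s expr0; ring.
have r21 : 0 <= 2 * r + 1 by rewrite -s0E.
have first_bar : ((emp_mean Xs (u 0%N) w - delta 0%N)%:E <=
    Tsharp_bar P Xs (2 * r + 1) a)%E.
  rewrite EFinB leeBlDr// -deltaE//; apply: (le_trans first).
  (* The first rewriting also alters the error term on the right; the second restores it. *)
  rewrite s0E (_ : u 0%N = a \- (a \- u 0%N)); last first.
    by apply/funext => x /=; ring.
  rewrite (_ : a \- (a \- (a \- u 0%N)) = a \- u 0%N); last first.
    by apply/funext => x /=; ring.
  apply: (TsharpB same_law) => //.
  exact: centered_integrableB (Vu _ _).
apply: (@le_trans _ _ ((emp_mean Xs (u 0%N) w - delta 0%N)%:E +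
    2%:E * (\sum_(i < N) delta i)%:E)%E).
  rewrite -EFinM -EFinD lee_fin.
  by have := partial N (leqnn _); rewrite /u ltnn deltaN; lra.
apply: leeD.
  rewrite le_min; apply/andP; split.
    apply: (le_trans first_bar); rewrite lee_pemull ?lee_fin ?ler1n//.
    exact: (Tsharp_bar_ge0 same_law).
  (* For the radius, [- delta 0] is dropped and the starting point is used as an element of
     [calA]. *)
  apply: (@le_trans _ _ (emp_mean Xs (u 0%N) w)%:E).
    by rewrite lee_fin gerBl delta_ge0.
  apply: (le_trans first); apply: (le_trans (Tsharp_bar_ge _ _ _ _)).
  apply: ereal_sup_ubound; exists (u 0%N) => //.
  exact: (int_level_sub adB (Du _ _)).
apply: lee_wpmul2l; first by rewrite lee_fin.
rewrite sumE big_mkord; apply: lee_sum => i _.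
by rewrite /u ltn_ord; have [] := pP i.
Qed.

End chaining.

(** * Passage to the infimum over admissible sequences *)

Section gamma_bound.
Context d d' (Omega : measurableType d) (S : measurableType d') (R : realType)
  (P : probability Omega R) (X : {mfun Omega >-> S}) (n : nat)
  (Xs : 'I_n -> {mfun Omega >-> S}).
Hypothesis same_law : forall i (E : set S), measurable E ->
  distribution P (Xs i) E = distribution P X E.
Local Notation V := (centered_integrable P X).
Context (calA : set (S -> R)) (r : R) (l0 : int).
Hypotheses (r0 : 0 < r) (l0r : l0%:~R <= ln (r / 3) / ln 2).
Hypotheses (finA : finite_set calA) (AV : calA `<=` V).

Let M a := mine (2%:E * Tsharp_bar P Xs (2 * r + 1) a)%E
                (rad_sharp P Xs (2 * r + 1) calA).

Let r21 : 0 <= 2 * r + 1.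
Proof. by rewrite addr_ge0// mulr_ge0// ltW. Qed.

Lemma rho_sharp_ge0 s a (H : set (S -> R)) : 0 <= s -> V a -> H `<=` V ->
  (0 <= rho_sharp P Xs s a H)%E.
Proof.
move=> s0 Va HV; apply: le_ereal_inf_tmp => _ [h Hh <-].
apply: (Tsharp_bar_ge0 same_law) => //.
by apply: centered_integrableB => //; exact: HV.
Qed.

Let rho_ge0 B a j : admissible calA B -> calA a ->
  (0 <= rho_sharp P Xs (r + (r + 1) * 2 ^+ j)%R a (int_level B (l0 + j%:Z)))%E.
Proof.
move=> adB Aa; apply: rho_sharp_ge0; last 2 first.
- exact: AV.
- exact: subset_trans (int_level_sub adB) AV.
by rewrite addr_ge0 ?mulr_ge0 ?addr_ge0 ?exprn_ge0// ltW.
Qed.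

(** Each supremum dominates the series of the zero function, which belongs to [calA] whenever an
    admissible sequence exists. *)
Lemma gamma_sharp_ge0 : (0 <= gamma_sharp P Xs calA r l0)%E.
Proof.
apply: le_ereal_inf_tmp => _ [B adB <-].
have A0 := admissible_mem0 adB.
apply: (@le_trans _ _ (\sum_(0 <= j <oo) rho_sharp P Xs
  (r + (r + 1) * 2 ^+ j)%R (cst 0%R) (int_level B (l0 + j%:Z)%R))%E).
  by apply: nneseries_ge0 => j _ _; exact: rho_ge0.
by apply: ereal_sup_ubound; exists (cst 0).
Qed.

Lemma main_term_fin_num a : calA a -> M a \is a fin_num.
Proof.
move=> Aa; have Tfin b : calA b -> Tsharp_bar P Xs (2 * r + 1) b \is a fin_num.
  by move=> Ab; apply: (Tsharp_bar_fin_num same_law) => //; exact: AV.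
have T0 : (0 <= Tsharp_bar P Xs (2 * r + 1) a)%E.
  by apply: (Tsharp_bar_ge0 same_law) => //; exact: AV.
rewrite ge0_fin_numE.
  apply: (@le_lt_trans _ _ (2%:E * Tsharp_bar P Xs (2 * r + 1) a)%E).
    by rewrite /M ge_min lexx.
  by rewrite -(fineK (Tfin _ Aa)) -EFinM ltry.
rewrite /M le_min mule_ge0//=; apply: (le_trans T0).
by apply: ereal_sup_ubound; exists a.
Qed.

Let measurable_deviation a : calA a ->
  measurable_fun setT (fun w => (emp_mean Xs a w - fine (M a)) / 2).
Proof.
move=> /AV[ma _ _]; apply: measurable_funM => //; apply: measurable_funB => //.
exact: measurable_emp_mean.
Qed.

(** Some admissible sequence has value below [v], and chaining applies to its completion. Solving
    the chaining inequality for the error sum makes the events superlevel sets of one family of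
    functions, so that [v] can later decrease to the infimum. *)
Let chaining_gamma_lt v : (gamma_sharp P Xs calA r l0 < v%:E)%E ->
  (P (\bigcup_(a in calA)
        [set w | (v < (emp_mean Xs a w - fine (M a)) / 2)%R])
     <= (expR (- r))%:E)%E.
Proof.
move=> /ereal_inf_lt[_ [B adB <-] Bv].
have cB := completed_admissible finA adB.
(* Adding the absolute value of [l0] places level [l0 + N] beyond [#|calA|] for either sign of
   [l0]. *)
pose N := (`|l0| + #|` fset_set calA|.+1)%N.
have [m mA lN] : exists2 m, (#|` fset_set calA| < m)%N & l0 + N%:Z = m%:Z.
  rewrite /N; case: (l0) => m.
    by exists (m + (m + #|` fset_set calA|.+1))%N => //; rewrite -ltnS; lia.
  by exists #|` fset_set calA|.+1 => //; lia.
have cBN : int_level (completed calA B) (l0 + N%:Z) = calA.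
  by rewrite lN; exact: int_level_completed_eq.
have [bad [mbad Pbad badP]] := chaining same_law r0 l0r finA AV cB cBN.
apply: (le_trans _ Pbad); apply: le_measure; rewrite ?inE//.
  apply: fin_bigcup_measurable => // a Aa.
  exact/measurable_superlevel/measurable_deviation.
move=> w [a Aa] /= vlt; apply: contrapT => /badP/(_ a Aa).
rewrite -/(M a) -(fineK (main_term_fin_num Aa)) -leeBlDl// -EFinB => h.
move: vlt; apply/negP; rewrite -leNgt ler_pdivrMr// mulrC -lee_fin.
apply: (le_trans h); rewrite EFinM.
apply: lee_wpmul2l; first by rewrite lee_fin.
apply/ltW; apply: le_lt_trans Bv.
apply: (@le_trans _ _ (\sum_(0 <= j <oo) rho_sharp P Xs
  (r + (r + 1) * 2 ^+ j)%R a (int_level B (l0 + j%:Z)%R))%E); last first.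
  by apply: ereal_sup_ubound; exists a.
apply: (@le_trans _ _ (\sum_(0 <= j < N) rho_sharp P Xs
  (r + (r + 1) * 2 ^+ j)%R a (int_level B (l0 + j%:Z)%R))%E); last first.
  by apply: nneseries_lim_ge => j _ _; exact: rho_ge0.
(* Completion enlarges the sets, hence decreases the infima. *)
apply: lee_sum => j _; apply: ereal_inf_le_tmp; apply: image_subset.
by apply: int_level_completed_sup; exact: int_level_sub.
Qed.

Lemma chaining_gamma c : gamma_sharp P Xs calA r l0 = c%:E ->
  (P (\bigcup_(a in calA)
        [set w | (c < (emp_mean Xs a w - fine (M a)) / 2)%R])
     <= (expR (- r))%:E)%E.
Proof.
move=> gc; apply: superlevel_bigcup_measure_le => // v cv.
by apply: chaining_gamma_lt; rewrite gc lte_fin.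
Qed.

End gamma_bound.

(** * Combination of the bounds for [A f] and [f - A f] *)

Theorem theorem2 (d d' : measure_display) (Omega : measurableType d)
    (S : measurableType d') (R : realType) (P : probability Omega R)
    (X : {RV P >-> S}) (n : nat) (Xs : 'I_n -> {RV P >-> S})
    (F : set (S -> R)) (A : (S -> R) -> (S -> R)) (k : nat) (r : R)
    (n_gt0 : (0 < n)%N)
    (iidX : iid_copies P X Xs)
    (FV : F `<=` centered_integrable P X)
    (finF : finite_set F)
    (F0 : F (cst 0))
    (AF : forall f, F f -> F (A f))
    (hr : ln 2 <= r)
    (hT : forall f, F f ->
      (Tsharp_bar P Xs (r + k%:R) (A f) <= Tsharp_bar P Xs (r + k%:R) f)%E)
    (hcard : (#|` fset_set (A @` F)|%fset)%:R <= expR (k%:R : R)) :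
  let calA := [set f \- A f | f in F] in
  let l0 := Num.floor (ln (r / 3) / ln 2) in
  ((1 - 2 * expR (- r))%:E <=
   P [set w | forall f, F f ->
        ((emp_mean Xs f w)%:E - Tsharp_bar P Xs (r + k%:R) f
         - mine (2%:E * Tsharp_bar P Xs (2 * r + 1) (f \- A f)%R)
                (rad_sharp P Xs (2 * r + 1) calA)
         <= 2%:E * gamma_sharp P Xs calA r l0)%E])%E.
Proof.
cbv zeta; set calA := [set f \- A f | f in F]; set l0 := Num.floor _.
have [_ same_law] := iidX.
have r0 : 0 < r by apply: lt_le_trans hr; rewrite ln_gt0// ltr1n.
have rk0 : 0 <= r + k%:R by rewrite addr_ge0// ltW.
have r21 : 0 <= 2 * r + 1 by rewrite addr_ge0// mulr_ge0// ltW.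
have l0r : l0%:~R <= ln (r / 3) / ln 2 := floor_le _.
have finA : finite_set calA by exact: finite_image.
have VA f (Ff : F f) : centered_integrable P X (f \- A f).
  by apply: centered_integrableB; apply: FV => //; exact: AF.
have AV : calA `<=` centered_integrable P X by move=> _ [f Ff <-]; exact: VA.
set G := [set w | _].
have mG : measurable G.
  pose Gf f := [set w | ((emp_mean Xs f w)%:E - Tsharp_bar P Xs (r + k%:R) f
         - mine (2%:E * Tsharp_bar P Xs (2 * r + 1) (f \- A f)%R)
                (rad_sharp P Xs (2 * r + 1) calA)
         <= 2%:E * gamma_sharp P Xs calA r l0)%E].
  rewrite (_ : G = \bigcap_(f in F) Gf f); last by [].
  apply: fin_bigcap_measurable => // f Ff.
  rewrite -[X in measurable X]setTI; apply: measurable_lee => //.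
  apply: emeasurable_funB => //; apply: emeasurable_funB => //.
  apply/measurable_EFinP; apply: measurable_emp_mean.
  by have [] := FV _ Ff.
have := gamma_sharp_ge0 same_law l0 r0 AV.
(* If [gamma_sharp] is [+oo] the event is the whole space. This happens in particular when [calA]
   does not contain the zero function, as no sequence is then admissible. *)
case gE : (gamma_sharp P Xs calA r l0) => [c| |] // _; last first.
  rewrite (_ : G = setT) ?probability_setT.
    by rewrite lee_fin lerBlDr lerDl mulr_ge0// expR_ge0.
  by apply/seteqP; split => // w _ f Ff; rewrite gE gt0_muley ?leey.
pose bad1 := \bigcup_(g in A @` F)
  [set w | (Tsharp P Xs (r + k%:R) g < (emp_mean Xs g w)%:E)%E].
have finAF : finite_set (A @` F) by exact: finite_image.
have VAF g : (A @` F) g -> centered_integrable P X g.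
  by move=> [f Ff <-]; apply: FV; exact: AF.
have [mbad1 Pbad1] := exceedance_bigcup_le same_law rk0 finAF VAF.
rewrite -/bad1 in mbad1 Pbad1.
have {}Pbad1 : (P bad1 <= (expR (- r))%:E)%E.
  apply: (le_trans Pbad1); rewrite lee_fin.
  apply: le_trans (ler_wpM2r (expR_ge0 _) hcard) _.
  (* The [e^k] functions in the range cancel the extra [k] in the level [r + k]. *)
  by rewrite -expRD ler_expR opprD addrCA subrr addr0.
pose M a := mine (2%:E * Tsharp_bar P Xs (2 * r + 1) a)%E
                 (rad_sharp P Xs (2 * r + 1) calA).
have := chaining_gamma same_law r0 l0r finA AV gE.
set bad2 := (X in P X) => Pbad2.
have mbad2 : measurable bad2.
  apply: fin_bigcup_measurable => // a /AV[ma _ _].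
  apply/measurable_superlevel/measurable_funM => //.
  apply: measurable_funB => //.
  exact: measurable_emp_mean.
have sub : ~` (bad1 `|` bad2) `<=` G.
  move=> w /not_orP[nb1 nb2] f Ff; rewrite gE.
  have Af : calA (f \- A f) by exists f.
  have Mfin := main_term_fin_num same_law r0 AV Af.
  have Tfin : Tsharp_bar P Xs (r + k%:R) f \is a fin_num.
    by apply: (Tsharp_bar_fin_num same_law) => //; exact: FV.
  (* Hypothesis [hT] exchanges the bound attached to [A f] for the one attached to [f]. *)
  have h1 : ((emp_mean Xs (A f) w)%:E <= Tsharp_bar P Xs (r + k%:R) f)%E.
    apply: le_trans (hT f Ff); apply: le_trans (Tsharp_bar_ge _ _ _ _).
    by rewrite leNgt; apply/negP => h; apply: nb1; exists (A f) => //; exists f.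
  have h2 : (emp_mean Xs (f \- A f) w - fine (M (f \- A f))) / 2 <= c.
    rewrite leNgt; apply/negP => h; apply: nb2.
    by exists (f \- A f).
  rewrite -(fineK Tfin) -(fineK Mfin) -!EFinB -EFinM lee_fin.
  move: h1 h2; rewrite -{1}(fineK Tfin) lee_fin emp_meanB /M.
  set m := fine _; set t := fine _ => h1 h2.
  move: h1 h2; rewrite ler_pdivrMr// -/m; lra.
apply: (@le_trans _ _ (P (~` (bad1 `|` bad2)))); last first.
  by apply: le_measure; rewrite ?inE//; apply/measurableC/measurableU.
rewrite probability_setC; last exact: measurableU.
have Pbad : (P (bad1 `|` bad2) <= (2 * expR (- r))%:E)%E.
  apply: (le_trans (measureU2 _ _ _)) => //.
  by rewrite mulr_natl mulr2n EFinD; apply: leeD.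
by rewrite EFinB; apply: leeB.
Qed.
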